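(* Let $H$ be a real Hilbert space. Let $A:H\to 2^H$ and $B:H\to 2^H$ be two maximally monotone operators. Let $C:H\to H$ be a $\beta$-cocoercive operator, for some $\beta>0$. Define an operator $T:H\to H$ by $$T:=I-J_{\gamma B}+J_{\gamma A}(2J_{\gamma B}-I-\gamma CJ_{\gamma B}).$$ For any given $z^0,z^{-1}\in H$, let the sequences $\{z^k\},\{x_A^k\},\{x_B^k\}$ be generated, for $k=0,1,2,\dots$, by $$\begin{aligned} y^k&=z^k+\alpha_k(z^k-z^{k-1}),\\ x_B^k&=J_{\gamma B}y^k,\\ x_A^k&=J_{\gamma A}(2x_B^k-y^k-\gamma Cx_B^k),\\ z^{k+1}&=y^k+\lambda_k(x_A^k-x_B^k).\end{aligned}$$ Assume that the parameters $\gamma$, $\{\alpha_k\}$ and $\{\lambda_k\}$ satisfy the following conditions: (i1) $\gamma\in(0,2\beta\overline{\varepsilon})$, where $\overline{\varepsilon}\in(0,1)$; (i2) $\{\alpha_k\}_{k\ge 1}$ is nondecreasing, $\alpha_1=0$ and $0\le\alpha_k\le\alpha<1$; (i3) for every $k\ge 1$, and $\lambda,\sigma,\delta>0$ such that $$\delta>\frac{\alpha^2(1+\alpha)+\alpha\sigma}{1-\alpha^2}\quad\text{and}\quad 0<\lambda\le\lambda_k\le\frac{\delta-\alpha[\alpha(1+\alpha)+\alpha\delta+\sigma]}{\overline{\alpha}\,\delta[1+\alpha(1+\alpha)+\alpha\delta+\sigma]},$$ where $\overline{\alpha}=\frac{1}{2-\overline{\varepsilon}}$. Then the following hold. (i)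 $\{z^k\}$ converges weakly to a fixed point of $T$. (ii) Let $\lambda_k\ge\underline{\lambda}>0$ and let $z^*$ be a fixed point of $T$. Then $\{x_B^k\}$ converges weakly to $J_{\gamma B}z^*\in\mathrm{zer}(A+B+C)$. (iii) Let $\lambda_k\ge\underline{\lambda}>0$ and let $z^*$ be a fixed point of $T$. Then $\{x_A^k\}$ converges weakly to $J_{\gamma B}z^*\in\mathrm{zer}(A+B+C)$. (iv) Let $\lambda_k\ge\underline{\lambda}>0$ and let $z^*$ be a fixed point of $T$. Suppose that one of the following conditions holds: (a) $A$ is uniformly monotone on every nonempty bounded subset of $\mathrm{dom}\,A$; (b) $B$ is uniformly monotone on every nonempty bounded subset of $\mathrm{dom}\,B$; (c) $C$ is demiregular at every point $x\in\mathrm{zer}(A+B+C)$. Then $\{x_A^k\}$ and $\{x_B^k\}$ converge strongly to $J_{\gamma B}z^*\in\mathrm{zer}(A+B+C)$.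
   Context: $I$ is the identity operator on $H$. For a set-valued operator $A:H\to 2^H$: $\mathrm{dom}\,A=\{x\in H: Ax\neq\emptyset\}$, $\mathrm{gra}\,A=\{(x,u)\in H\times H: u\in Ax\}$, $\mathrm{zer}\,A=\{x\in H: 0\in Ax\}$. $A$ is monotone if $\langle x-y,u-v\rangle\ge0$ for all $(x,u),(y,v)\in\mathrm{gra}\,A$, and maximally monotone if moreover its graph is not strictly contained in the graph of any other monotone operator. For $A$ maximally monotone and $\gamma>0$, the resolvent is $J_{\gamma A}=(I+\gamma A)^{-1}$, a single-valued map $H\to H$. $C:H\to H$ is $\beta$-cocoercive if $\langle x-y,Cx-Cy\rangle\ge\beta\|Cx-Cy\|^2$ for all $x,y\in H$. $A$ is uniformly monotone if there is an increasing function $\psi:[0,+\infty)\to[0,+\infty]$ vanishing only at $0$ such that $\langle x-y,u-v\rangle\ge\psi(\|x-y\|)$ for all $(x,u),(y,v)\in\mathrm{gra}\,A$; it is uniformly monotone on a set $S\subseteq\mathrm{dom}\,A$ if this holds (with $\psi$ depending on $S$) for all such pairs with $x,y\in S$. $A$ is demiregular at $x\in\mathrm{dom}\,A$ if for all $u\in Ax$ and all sequences $(x^k,u^k)\in\mathrm{gra}\,A$ with $x^k\rightharpoonup x$ (weakly) and $u^k\to u$ (strongly), one has $x^k\to x$ strongly; a single-valued operator is regarded as a set-valued one with singleton values.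
   Formalization: The formal theorem assumes zer(A+B+C) is nonempty (otherwise T may have no fixed point), and in (ii), (iii) and (iv)(c) takes z* to be the fixed point that is the weak limit of z^k (for an arbitrary fixed point the claim fails when A=B=C=0). *)

(* Defs.v *)
From HB Require Import structures.
From mathcomp Require Import all_boot all_order all_algebra sesquilinear.
From mathcomp Require Import all_classical all_reals all_analysis.

Set Implicit Arguments.
Unset Strict Implicit.
Unset Printing Implicit Defensive.

Import Order.TTheory GRing.Theory Num.Theory.
Import numFieldNormedType.Exports.

Local Open Scope classical_set_scope.
Local Open Scope ring_scope.

Section SetValuedOperators.
Context {R : realType} {H : completeNormedModType R}.

(* Set-valued operators A : H -> 2^H are functions H -> set H. *)

Definition dom (A : H -> set H) : set H := [set x | A x !=set0].

Definition gra (A : H -> set H) : set (H * H) := [set p | A p.1 p.2].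

Definition zer (A : H -> set H) : set H := [set x | A x 0].

Definition op_inv (A : H -> set H) : H -> set H := fun u => [set x | A x u].

Definition op_of_fun (F : H -> H) : H -> set H := fun x => [set F x].

Definition op_add (A B : H -> set H) : H -> set H :=
  fun x => [set u + v | u in A x & v in B x].

Definition op_scale (c : R) (A : H -> set H) : H -> set H :=
  fun x => [set c *: u | u in A x].

(* J_{gamma A} = (I + gamma A)^{-1}. For A maximally monotone and gamma > 0
   the set below is a singleton (Minty); outside that case [get] returns an
   arbitrary element of the set, or the default point if it is empty. *)
Definition resolvent (gamma : R) (A : H -> set H) : H -> H :=
  fun z => get (op_inv (op_add (op_of_fun id) (op_scale gamma A)) z).

Definition three_operator (gamma : R) (A B : H -> set H) (C : H -> H)
    : H -> H :=
  let JA := resolvent gamma A in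
  let JB := resolvent gamma B in
  fun z => z - JB z + JA (2 *: JB z - z - gamma *: C (JB z)).

End SetValuedOperators.

Section InnerProduct.
Context {R : realType} {H : completeNormedModType R}.
Variable dot : {dot H for (@idfun R)}.

(* The norm of H is the one induced by dot; since H is complete, this makes
   (H, dot) a real Hilbert space. *)
Definition induces_norm : Prop := forall x : H, `|x| ^+ 2 = dot x x.

Definition weakly_cvg (x : nat -> H) (l : H) : Prop :=
  forall u : H, dot (x k) u @[k --> \oo] --> dot l u.

Definition monotone_op (A : H -> set H) : Prop :=
  forall x u y v, gra A (x, u) -> gra A (y, v) -> 0 <= dot (x - y) (u - v).

Definition maximally_monotone (A : H -> set H) : Prop :=
  monotone_op A /\
  forall A' : H -> set H, monotone_op A' -> ~ (gra A `<` gra A').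

Definition cocoercive (beta : R) (C : H -> H) : Prop :=
  forall x y, beta * `|C x - C y| ^+ 2 <= dot (x - y) (C x - C y).

(* Moduli are functions [0, +oo[ -> [0, +oo]; only the values of psi on
   nonnegative reals matter. As usual in monotone operator theory,
   "increasing" is not meant strictly. *)
Definition modulus (psi : R -> \bar R) : Prop :=
  [/\ forall t, 0 <= t -> (0 <= psi t)%E,
      forall s t, 0 <= s -> s <= t -> (psi s <= psi t)%E &
      forall t, 0 <= t -> (psi t = 0%E <-> t = 0)].

Definition uniformly_monotone_on (A : H -> set H) (S : set H) : Prop :=
  exists psi : R -> \bar R, modulus psi /\
    forall x u y v, S x -> S y -> gra A (x, u) -> gra A (y, v) ->
      (psi (`|x - y|)%R <= (dot (x - y) (u - v))%R%:E)%E.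

Definition uniformly_monotone_on_bounded (A : H -> set H) : Prop :=
  forall S : set H, S `<=` dom A -> S !=set0 -> bounded_set S ->
    uniformly_monotone_on A S.

Definition demiregular_at (A : H -> set H) (x : H) : Prop :=
  forall u, A x u -> forall xk uk : nat -> H,
    (forall k, gra A (xk k, uk k)) ->
    weakly_cvg xk x -> uk @ \oo --> u -> xk @ \oo --> x.

End InnerProduct.

(* Main.v *)
Require Import Defs.
From mathcomp Require Import all_boot all_order all_algebra sesquilinear.
From mathcomp Require Import all_classical all_reals all_analysis.
From mathcomp Require Import ring lra.

Import Order.TTheory GRing.Theory Num.Theory.
Import numFieldNormedType.Exports.

Local Open Scope classical_set_scope.
Local Open Scope ring_scope.

(** The operator T is z - r(z), where r(z) = x_B - x_A is the gap between the
    two resolvent steps taken from z, so the fixed points of T are the zeros of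
    r; J_{gamma B} sends them to the zeros of A + B + C, and every zero of
    A + B + C is obtained in this way.  Everything rests on one inequality
    ([residual_cocoercive]): for some c > 0 and all z, w
      (2 - epsb) |r z - r w|^2 + c |C x_B(z) - C x_B(w)|^2
        + 2 gamma (P_B + P_A) <= 2 <z - w, r z - r w>,
    where P_A and P_B are the nonnegative products given by the monotonicity of
    A and B at the two resolvent steps.  It is an identity
    ([residual_identity]) combined with the cocoercivity of C and Young's
    inequality.

    Take for w a fixed point s of T, so that r s = 0.  The first term turns a
    relaxed step y - lambda r(y) into a decrease of |. - s|^2.  With the
    extrapolation y^k = z^k + alpha_k (z^k - z^{k-1}) and the bounds on alpha_k
    and lambda_k, the energy
      |z^{k+1} - s|^2 - alpha_{k+1} |z^k - s|^2 + g |z^{k+1} - z^k|^2,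
    with g = alpha (1 + alpha) + alpha delta, decreases by at least
    sigma |z^{k+2} - z^{k+1}|^2 at each step ([inertial_descent],
    [inertial_cvg]).  Hence |z^k - s| converges for every fixed point s, the
    increments tend to 0, and so does r(y^k).

    Weak convergence of z^k is then Opial's argument ([opial]): r is demiclosed
    at 0 ([residual_demiclosed], again from the inequality), so all weak cluster
    points are fixed points, and two of them coincide because the distances to
    both converge.  The other terms of the inequality, whose right-hand side
    tends to 0 along y^k, give C x_B^k -> C x_B(s) strongly and P_A, P_B -> 0
    ([residual_vanish]).  If z^k converges weakly to s, this pins down the weak
    cluster points of x_B^k ([resolventB_weak_cluster]).  Under uniform
    monotonicity the vanishing of P_A or P_B forces strong convergence, and
    demiregularity applies directly to C x_B^k.

    Two classical existence results are needed: Minty's theorem, for the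
    resolvents to be defined everywhere, and the existence of weak limits of
    bounded sequences.  Both come from minimizing a function |w|^2 + s over a
    convex set of pairs (w, s) ([convex_minimizer]).  Weak limits are taken
    along ultrafilters, on which every bounded scalar sequence converges, so
    that no subsequence has to be extracted. *)

(** * Convergence along ultrafilters *)

Section Ultrafilters.
Set Implicit Arguments.
Unset Strict Implicit.
Unset Printing Implicit Defensive.

(** If f failed to send F into a neighborhood P of l, the complement of the
    preimage of P could be added to F, and an ultrafilter containing both would
    contradict the hypothesis. *)
Lemma cvg_ultra {T : Type} {V : topologicalType} {F : set_system T}
    {FF : Filter F} (f : T -> V) (l : V) :
  (forall U, UltraFilter U -> F `<=` U -> f t @[t --> U] --> l) ->
  f t @[t --> F] --> l.
Proof.
move=> fU P Pl; apply: contrapT => nFP.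
have wF : ProperFilter (within (~` (f @^-1` P)) F).
  apply: Build_ProperFilter_ex => B FB; apply: contrapT => B0; apply: nFP.
  change (F (f @^-1` P)); move: FB; rewrite /within /prop_near1 /nbhs /=.
  apply: filterS => t Bt; apply: contrapT => nPt.
  by apply: B0; exists t; exact: Bt.
have [U [UU wU]] := ultraFilterLemma wF.
have FU : F `<=` U.
  by move=> B FB; exact: wU _ (@cvg_within _ F _ _ B FB).
have UP : U (f @^-1` P) by exact: (fU U UU FU P Pl).
have UnP : U (~` (f @^-1` P)) by apply: wU; exact: withinT.
have [t [Pt nPt]] := filter_ex (filterI UP UnP).
exact: nPt.
Qed.

Lemma bounded_ultra_cvg {T : Type} {R : realType} {U : set_system T}
    {UU : UltraFilter U} (f : T -> R) (M : R) :
  (forall t, `|f t| <= M) -> exists l : R, f t @[t --> U] --> l.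
Proof.
move=> fM; have fin : (f @ U) `[- M, M]%classic.
  change (U (f @^-1` `[- M, M]%classic)); apply: filterE => t.
  by rewrite /= in_itv /= -ler_norml.
have [l [_ lcl]] := @segment_compact R (- M) M (f @ U) _ fin.
exists l => P Pl; have [//|UnP] := in_ultra_setVsetC (f @^-1` P) UU.
have [r [nPr Pr]] := lcl (~` P) P UnP Pl.
by [].
Qed.

End Ultrafilters.

(** * Inertial real sequences *)

Section InertialSequences.
Set Implicit Arguments.
Unset Strict Implicit.
Unset Printing Implicit Defensive.
Context {R : realType}.
Implicit Types (phi d a : nat -> R).

(** The error phi n - l / (1 - alpha) is contracted by alpha at each step, up to
    a perturbation that is eventually at most (e / 2) (1 - alpha); the geometric
    sum of these perturbations stays below e / 2. *)
Lemma cvg_of_cvg_inertial phi (alpha l : R) :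
  0 <= alpha < 1 ->
  phi n.+1 - alpha * phi n @[n --> \oo] --> l ->
  phi n @[n --> \oo] --> l / (1 - alpha).
Proof.
move=> /andP[alpha0 alpha1] phil.
have c0 : 0 < 1 - alpha by rewrite subr_gt0.
pose L := l / (1 - alpha).
have LE : L * (1 - alpha) = l by rewrite /L divfK // gt_eqF.
apply/cvgrPdist_le => e e0.
have e2 : 0 < e / 2 * (1 - alpha) by rewrite mulr_gt0 // divr_gt0.
have /cvgrPdist_le /(_ _ e2) [N _ NP] := phil.
have step n : (N <= n)%N ->
    `|phi n.+1 - L| <= alpha * `|phi n - L| + e / 2 * (1 - alpha).
  move=> /NP; rewrite distrC => h.
  have -> : phi n.+1 - L = alpha * (phi n - L) + (phi n.+1 - alpha * phi n - l).
    by rewrite -LE; ring.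
  by apply: le_trans (ler_normD _ _) _; rewrite normrM (ger0_norm alpha0) lerD2l.
have geo k : `|phi (N + k)%N - L| <= alpha ^+ k * `|phi N - L| + e / 2.
  elim: k => [|k IH]; first by rewrite addn0 expr0 mul1r lerDl; lra.
  rewrite addnS; apply: le_trans (step _ (leq_addr _ _)) _.
  have := ler_wpM2l alpha0 IH; rewrite exprS; lra.
have /cvgrPdist_le /(_ _ (divr_gt0 e0 (ltr0Sn R 1))) [K _ KP] :
    alpha ^+ k * `|phi N - L| @[k --> \oo] --> 0.
  rewrite -(mul0r `|phi N - L|); apply: cvgMr_tmp; apply: cvg_expr.
  by rewrite ger0_norm.
exists (N + K)%N => // n /= NKn.
have Nn : (N <= n)%N by apply: leq_trans NKn; exact: leq_addr.
have := KP (n - N)%N; rewrite /= leq_subRL // sub0r normrN => /(_ NKn).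
rewrite ger0_norm; last by rewrite mulr_ge0 // exprn_ge0.
have := geo (n - N)%N; rewrite subnKC // distrC.
lra.
Qed.

(** The energy mu n = phi n.+1 - a n.+1 * phi n + g * d n.+1 is nonincreasing
    because a is, and it starts nonnegative because a 1 = 0.  This bounds phi by
    a geometric recursion, so mu converges and d tends to 0; then phi n.+1 -
    a n.+1 * phi n converges, and a itself converges to a limit below 1. *)
Lemma inertial_cvg phi d a (alpha g sigma : R) :
  (forall n, 0 <= phi n) -> (forall n, 0 <= d n) ->
  a 1%N = 0 -> (forall n, a n.+1 <= a n.+2) ->
  (forall n, 0 <= a n.+1 <= alpha) -> alpha < 1 -> 0 <= g -> 0 < sigma ->
  (forall n, phi n.+2 <= phi n.+1 + a n.+1 * (phi n.+1 - phi n) -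
                         (g + sigma) * d n.+2 + g * d n.+1) ->
  cvg (phi n @[n --> \oo]) /\ d n @[n --> \oo] --> 0.
Proof.
move=> phi0 d0 a1 a_nd a_bd alpha1 g0 sigma0 descent.
have a0 n : 0 <= a n.+1 by case/andP: (a_bd n).
have aalpha n : a n.+1 <= alpha by case/andP: (a_bd n).
have alpha0 : 0 <= alpha by apply: le_trans (a0 0%N) (aalpha 0%N).
pose mu n := phi n.+1 - a n.+1 * phi n + g * d n.+1.
have mu_step n : mu n.+1 + sigma * d n.+2 <= mu n.
  have := ler_wpM2r (phi0 n.+1) (a_nd n); have := descent n; rewrite /mu; lra.
have mu_ni : nonincreasing_seq mu.
  apply/nonincreasing_seqP => n.
  by have := mu_step n; have := mulr_ge0 (ltW sigma0) (d0 n.+2); lra.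
pose mu0 := mu 0%N.
have mu0_ge0 : 0 <= mu0.
  by rewrite /mu0 /mu a1 mul0r subr0 addr_ge0 ?mulr_ge0.
pose M := phi 0%N + phi 1%N + mu0 / (1 - alpha).
have c0 : 0 < 1 - alpha by rewrite subr_gt0.
have muM : mu0 = (mu0 / (1 - alpha)) * (1 - alpha) by rewrite divfK // gt_eqF.
have muM0 : 0 <= mu0 / (1 - alpha) by rewrite divr_ge0 // ltW.
have phiM n : phi n <= M.
  elim: n => [|n IH]; first by rewrite /M -addrA lerDl addr_ge0.
  have : mu n <= mu0 by exact: mu_ni.
  have := mulr_ge0 g0 (d0 n.+1).
  have := ler_wpM2r (phi0 n) (aalpha n).
  have := ler_wpM2l alpha0 IH.
  have := mulr_ge0 (ltW c0) (addr_ge0 (phi0 0%N) (phi0 1%N)).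
  by rewrite /mu /M; lra.
have mu_cvg : cvgn mu.
  apply: nonincreasing_is_cvgn => //; exists (- (alpha * M)) => _ [n _ <-].
  have := mulr_ge0 g0 (d0 n.+1); have := ler_wpM2r (phi0 n) (aalpha n).
  have := ler_wpM2l alpha0 (phiM n); have := phi0 n.+1; rewrite /mu; lra.
have d_cvg : d n @[n --> \oo] --> 0.
  rewrite -cvg_shiftS -cvg_shiftS /=.
  apply: (@squeeze_cvgr _ _ _ _ (fun=> 0) (fun n => sigma^-1 * (mu n - mu n.+1))).
  - apply: filterE => n; rewrite d0 /= mulrC ler_pdivlMr // mulrC.
    by have := mu_step n; lra.
  - exact: cvg_cst.
  - rewrite -(mulr0 sigma^-1); apply: cvgMl_tmp.
    rewrite -(subrr (limn mu)); apply: cvgB => //.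
    by rewrite (cvg_shiftS mu).
split=> //.
have : cvgn (fun n => a n.+1).
  apply: nondecreasing_is_cvgn; first by apply/nondecreasing_seqP.
  by exists alpha => _ [n _ <-].
move=> /cvg_ex[ainf acvg].
have ainf01 : 0 <= ainf < 1.
  apply/andP; split; first by apply: (cvgr_to_ge acvg); exact: filterE.
  by apply: le_lt_trans alpha1; apply: (cvgr_to_le acvg); exact: filterE.
apply: cvgP; apply: (cvg_of_cvg_inertial (alpha := ainf) (l := limn mu)) => //.
have -> : (fun n => phi n.+1 - ainf * phi n) =
   (fun n => mu n + ((a n.+1 - ainf) * phi n - g * d n.+1)).
  by apply/funext => n; rewrite /mu; ring.
rewrite -[limn mu]addr0; apply: cvgD => //.
rewrite -[0](subrr 0); apply: cvgB; last first.
  by rewrite -(mulr0 g); apply: cvgMl_tmp; rewrite (cvg_shiftS d).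
apply: norm_cvg0.
apply: (@squeeze_cvgr _ _ _ _ (fun=> 0) (fun n => `|a n.+1 - ainf| * M)).
- apply: filterE => n; rewrite normr_ge0 normrM (ger0_norm (phi0 n)) /=.
  by rewrite ler_wpM2l.
- exact: cvg_cst.
- rewrite -(mul0r M); apply: cvgMr_tmp; rewrite -(@normr0 _ R).
  by apply: cvg_norm; rewrite -(subrr ainf); apply: cvgB => //; exact: cvg_cst.
Qed.

End InertialSequences.

(** * Inner product calculus *)

Section Hilbert.
Set Implicit Arguments.
Unset Strict Implicit.
Unset Printing Implicit Defensive.
Context {R : realType} {H : completeNormedModType R}.
Variable dot : {dot H for (@idfun R)}.
Hypothesis hdot : induces_norm dot.
Implicit Types (x y z u v : H) (a : R).

Lemma dotC x y : dot x y = dot y x.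
Proof. by have := @hermC _ _ _ _ dot x y; rewrite expr0 mul1r. Qed.

Lemma dotDl x y z : dot (x + y) z = dot x z + dot y z.
Proof. exact: linearDl. Qed.

Lemma dotDr x y z : dot x (y + z) = dot x y + dot x z.
Proof. by rewrite dotC dotDl !(dotC x). Qed.

Lemma dotNl x z : dot (- x) z = - dot x z.
Proof. exact: linearNl. Qed.

Lemma dotNr x z : dot x (- z) = - dot x z.
Proof. by rewrite dotC dotNl dotC. Qed.

Lemma dotZl a x z : dot (a *: x) z = a * dot x z.
Proof. exact: linearZl_LR. Qed.

Lemma dotZr a x z : dot x (a *: z) = a * dot x z.
Proof. by rewrite dotC dotZl dotC. Qed.

Lemma dot0l z : dot 0 z = 0.
Proof. exact: linear0l. Qed.

Lemma dot0r z : dot z 0 = 0.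
Proof. by rewrite dotC dot0l. Qed.

Definition dotE := (dotDl, dotDr, dotNl, dotNr, dotZl, dotZr, dot0l, dot0r).

Lemma sqrnormE x : `|x| ^+ 2 = dot x x.
Proof. exact: hdot. Qed.

Lemma dot_ge0 x : 0 <= dot x x.
Proof. by rewrite -sqrnormE sqr_ge0. Qed.

Lemma dot_eq0 x : dot x x = 0 -> x = 0.
Proof.
by move=> /eqP; rewrite -sqrnormE expf_eq0 /= normr_eq0 => /eqP.
Qed.

(** Testing a vector identity against every u moves it into R, where it is a
    matter of commutative algebra. *)
Lemma dot_ext x y : (forall u, dot x u = dot y u) -> x = y.
Proof.
move=> xy; apply/eqP; rewrite -subr_eq0; apply/eqP/dot_eq0.
by rewrite [LHS]dotDl dotNl xy subrr.
Qed.

Lemma cauchy_schwarz x y : `|dot x y| <= `|x| * `|y|.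
Proof.
have [->|y0] := eqVneq y 0; first by rewrite dot0r !normr0 mulr0.
have yy : 0 < dot y y by rewrite -sqrnormE exprn_gt0 // normr_gt0.
rewrite -(@ler_pXn2r _ 2) ?nnegrE ?mulr_ge0 // exprMn !sqrnormE real_normK ?num_real //.
have := dot_ge0 (dot y y *: x - dot x y *: y).
rewrite !dotE (dotC y x).
rewrite [X in 0 <= X](_ : _ = dot y y * (dot x x * dot y y - dot x y ^+ 2));
  last by ring.
by rewrite pmulr_rge0 // subr_ge0.
Qed.

Lemma cvg_dot {T : Type} {F : set_system T} {FF : Filter F} (f g : T -> H) x y :
  f t @[t --> F] --> x -> g t @[t --> F] --> y ->
  dot (f t) (g t) @[t --> F] --> dot x y.
Proof.
have polarization u v :
    dot u v = (`|u + v| * `|u + v| - `|u - v| * `|u - v|) / 4.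
  by rewrite -!expr2 !sqrnormE !dotE (dotC v u); field.
move=> fx gy; rewrite polarization.
under eq_fun do rewrite polarization.
apply: cvgMr_tmp; apply: cvgB; apply: cvgM; apply: cvg_norm;
  by [exact: cvgD | exact: cvgB].
Qed.

(** * Minimization over convex sets *)

(** First order optimality condition for minimizing |w|^2 + s over a convex set
    of pairs (w, s).  Only the first component of a minimizing sequence has to
    converge, and it is a Cauchy sequence by the parallelogram law; K need not
    be closed, and the minimizer need not belong to it. *)
Lemma convex_minimizer (K : set (H * R)) (m : R) :
  K !=set0 ->
  (forall t p q, 0 <= t <= 1 -> K p -> K q ->
     K ((1 - t) *: p.1 + t *: q.1, (1 - t) * p.2 + t * q.2)) ->
  (forall p, K p -> m <= `|p.1| ^+ 2 + p.2) ->
  exists w : H, forall p, K p -> m + `|w| ^+ 2 <= 2 * dot w p.1 + p.2.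
Proof.
move=> K0 Kconv Km; pose f (p : H * R) := dot p.1 p.1 + p.2.
have Ebd : has_inf [set f p | p in K].
  split; first by case: K0 => p Kp; exists (f p), p.
  by exists m => _ [p Kp <-]; rewrite /f -sqrnormE; exact: Km.
pose mu := inf [set f p | p in K].
have mumin p : K p -> mu <= f p.
  by move=> Kp; apply: ge_inf; [exact: Ebd.2 | exists p].
have mmu : m <= mu.
  apply: lb_le_inf; first exact: Ebd.1.
  by move=> _ [p Kp <-]; rewrite /f -sqrnormE; exact: Km.
have /choice[s sP] (n : nat) : exists p, K p /\ f p < mu + n.+1%:R^-1.
  have n0 : 0 < n.+1%:R^-1 :> R by rewrite invr_gt0.
  have [_ [p Kp <-] fp] := inf_adherent n0 Ebd.
  by exists p.
have sK n : K (s n) by case: (sP n).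
have sf n : f (s n) < mu + n.+1%:R^-1 by case: (sP n).
(* The midpoint of s i and s j lies in K, hence has value at least mu. *)
have scauchy i j : `|(s i).1 - (s j).1| ^+ 2 <= 2 * (i.+1%:R^-1 + j.+1%:R^-1).
  have /mumin := Kconv 2^-1 _ _ ltac:(lra) (sK i) (sK j).
  have := sf i; have := sf j; rewrite sqrnormE /f /= !dotE (dotC (s j).1 (s i).1).
  by move: (i.+1%:R^-1) (j.+1%:R^-1) => ei ej; lra.
have [w sw] : exists w : H, (s n).1 @[n --> \oo] --> w.
  apply/cvg_ex/cauchy_cvgP/cauchy_ballP => e e0; near_simpl.
  have e4 : 0 < e ^+ 2 / 4 by rewrite divr_gt0 ?exprn_gt0.
  near=> n; rewrite -ball_normE /ball_ /=.
  rewrite -(@ltr_pXn2r _ 2) ?nnegrE // ?(ltW e0) //.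
  apply: le_lt_trans (scauchy _ _) _.
  have i4 : n.1.+1%:R^-1 < e ^+ 2 / 4.
    near: n; apply: (cvg_fst (near_infty_natSinv_lt (PosNum e4))).
  have j4 : n.2.+1%:R^-1 < e ^+ 2 / 4.
    near: n; apply: (cvg_snd (near_infty_natSinv_lt (PosNum e4))).
  by move: i4 j4; move: (n.1.+1%:R^-1) (n.2.+1%:R^-1) => a b; lra.
exists w => p Kp; rewrite sqrnormE.
apply: le_trans (_ : mu + dot w w <= _); first by rewrite lerD2r.
rewrite -subr_ge0.
have first_order t : 0 < t <= 1 ->
    0 <= t * (2 * dot w p.1 + p.2 - (mu + dot w w)) +
         t ^+ 2 * dot (p.1 - w) (p.1 - w).
  move=> t01; pose F n : R := n.+1%:R^-1 +
    (t * (2 * dot (s n).1 p.1 + p.2 - (mu + dot (s n).1 (s n).1)) +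
     t ^+ 2 * dot (p.1 - (s n).1) (p.1 - (s n).1)).
  have F0 n : 0 <= F n.
    have /mumin := Kconv t _ _ ltac:(lra) (sK n) Kp.
    have := sf n; rewrite /F /f /= !dotE (dotC p.1 (s n).1).
    have : 0 <= n.+1%:R^-1 :> R by rewrite invr_ge0.
    set c := n.+1%:R^-1; set sn := dot (s n).1 _ + _ => c0 sn_lt mule.
    have tc : 0 <= t * c by rewrite mulr_ge0 //; lra.
    have : (1 - t) * sn <= (1 - t) * (mu + c).
      by rewrite ler_wpM2l ?(ltW sn_lt) //; lra.
    by move: mule; rewrite /sn; lra.
  have : F n @[n --> \oo] --> 0 + (t * (2 * dot w p.1 + p.2 - (mu + dot w w)) +
         t ^+ 2 * dot (p.1 - w) (p.1 - w)).
    apply: cvgD; first exact: cvg_harmonic.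
    apply: cvgD; apply: cvgMl_tmp.
      apply: cvgB; last by apply: cvgD; [exact: cvg_cst | exact: cvg_dot].
      by apply: cvgD; [apply: cvgMl_tmp; apply: cvg_dot|]; try exact: cvg_cst.
    by apply: cvg_dot; apply: cvgB; try exact: cvg_cst.
  by rewrite add0r => /cvgr_to_ge; apply; near=> n; exact: F0.
(* If a < 0, then t * a + t ^+ 2 * b < 0 for the t in ]0, 1] that solves
   t * (b - a + 1) = - a. *)
set a := _ - _ in first_order *; set b := dot (p.1 - w) _ in first_order.
have b0 : 0 <= b by exact: dot_ge0.
rewrite leNgt; apply/negP => a0.
have t01 : 0 < - a / (b - a + 1) <= 1.
  by rewrite divr_gt0 ?ler_pdivrMr; lra.
have := first_order _ t01; set t := - a / _ in t01 *.
have : t * (b - a + 1) = - a by rewrite /t; field; lra.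
nra.
Unshelve. all: by end_near. Qed.

(** * Minty's theorem and resolvents *)

(** Otherwise adding (x, u) to the graph would extend it. *)
Lemma maximally_monotone_mem (A : H -> set H) x u :
  maximally_monotone dot A ->
  (forall y v, A y v -> 0 <= dot (x - y) (u - v)) -> A x u.
Proof.
move=> [Amono Amax] xuA; apply: contrapT => nAxu.
pose A' y := A y `|` [set v | y = x /\ v = u].
apply: (Amax A').
  move=> y v y' v' [Ayv|/= [-> ->]] [Ay'v'|/= [-> ->]].
  - exact: Amono.
  - by rewrite -[y - x]opprB -[v - u]opprB dotNl dotNr opprK; exact: xuA.
  - exact: xuA.
  - by rewrite !subrr dot0l.
split=> [[y v] Ayv|]; first by left.
by move=> /(_ (x, u)) => Axu; apply: nAxu; apply: Axu; right.
Qed.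

Lemma maximally_monotone_nonempty (A : H -> set H) :
  maximally_monotone dot A -> exists x u, A x u.
Proof.
move=> hA; apply: contrapT => A0; apply: (A0); exists 0, 0.
by apply: maximally_monotone_mem => // y v Ayv; case: A0; exists y, v.
Qed.

(** Minty's theorem in extension form: - x can be added to the graph at x
    without destroying monotonicity.

    The point x minimizes |w|^2 + S over a convex set K of pairs
    (w, S) = ((Y - V) / 2, S) which contains ((y - v) / 2, <y, v>) for each
    (y, v) in the graph; its optimality condition at these points is the claim.
    The minimum is nonnegative if S >= <Y, V> on K.  To get this without
    handling convex combinations, K is cut out by linear conditions: P says that
    the Fitzpatrick function of A at (Y, V) is at most S, and Q compares
    (Y, V, S) with all triples that satisfy P.  Points of the graph satisfy
    both, and Q tested on (Y, V, S) itself reads 2 <Y, V> <= 2 S. *)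
Lemma monotone_extension (A : H -> set H) :
  monotone_op dot A -> (exists x u, A x u) ->
  exists x, forall y v, A y v -> 0 <= dot (x - y) (- x - v).
Proof.
move=> Amono [y0 [v0 Ayv0]].
pose P (Y V : H) (S : R) :=
  forall y v, A y v -> dot Y v + dot V y <= S + dot y v.
pose Q (Y V : H) (S : R) :=
  forall Y' V' S', P Y' V' S' -> dot Y V' + dot V Y' <= S + S'.
pose K : set (H * R) := [set p | exists Y V,
  [/\ p.1 = 2^-1 *: (Y - V), P Y V p.2 & Q Y V p.2]].
have graphK y v : A y v -> K (2^-1 *: (y - v), dot y v).
  move=> Ayv; exists y, v; split=> // [y' v' Ay'v'|Y V S /(_ y v Ayv)] /=.
    have := Amono _ _ _ _ Ayv Ay'v'; rewrite !dotE (dotC v y').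
    by lra.
  by rewrite (dotC y V) (dotC v Y); lra.
have [|t p q t01 [Y [V [pE PY QY]]] [Y' [V' [qE PY' QY']]]|p [Y [V [-> PY QY]]]|w wP] :=
    @convex_minimizer K 0.
- by exists (2^-1 *: (y0 - v0), dot y0 v0); exact: graphK.
- exists ((1 - t) *: Y + t *: Y'), ((1 - t) *: V + t *: V'); split=> /=.
  + rewrite pE qE !scalerA ![_ * 2^-1]mulrC -!scalerA -scalerDr; congr (_ *: _).
    by rewrite !scalerBr opprD addrACA.
  + move=> y v Ayv; have := PY y v Ayv; have := PY' y v Ayv; rewrite !dotE.
    by nra.
  + move=> Y1 V1 S1 PS1; have := QY _ _ _ PS1; have := QY' _ _ _ PS1.
    by rewrite !dotE; nra.
- have := QY _ _ _ PY; have := dot_ge0 (Y + V).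
  by rewrite sqrnormE !dotE (dotC V Y); lra.
exists w => y v /graphK /wP /=.
by rewrite sqrnormE !dotE (dotC y w); lra.
Qed.

(** The extension form for the shifted operator gamma A - z gives an x such that
    z - x is monotonically related to gamma A at x; maximality of A then puts
    z - x in gamma A x. *)
Lemma minty (A : H -> set H) (gamma : R) : maximally_monotone dot A -> 0 < gamma ->
  forall z, exists x, A x (gamma^-1 *: (z - x)).
Proof.
move=> hA gamma0 z.
pose A' y : set H := [set gamma *: v - z | v in A y].
have [||x xP] := @monotone_extension A'.
- move=> x u' y v'; rewrite /gra /= => -[u Axu <-] [v Ayv <-].
  rewrite (_ : _ - z - _ = gamma *: (u - v)).
    by rewrite dotZr mulr_ge0 ?(ltW gamma0) //; exact: hA.1.
  by rewrite opprB addrA subrK scalerBr.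
- have [x [u Axu]] := maximally_monotone_nonempty hA.
  by exists x, (gamma *: u - z), u.
exists x; apply: maximally_monotone_mem => // y v Ayv.
have -> : gamma^-1 *: (z - x) - v = gamma^-1 *: (- x - (gamma *: v - z)).
  rewrite opprB addrCA addrA [in RHS]scalerBr.
  by rewrite scalerA mulVf ?gt_eqF // scale1r.
rewrite dotZr mulr_ge0 ?invr_ge0 ?(ltW gamma0) //.
by apply: xP; exists v.
Qed.

Lemma resolvent_mem (A : H -> set H) (gamma : R) z :
  maximally_monotone dot A -> 0 < gamma ->
  A (resolvent gamma A z) (gamma^-1 *: (z - resolvent gamma A z)).
Proof.
move=> hA gamma0.
have : op_inv (op_add (op_of_fun id) (op_scale gamma A)) z (resolvent gamma A z).
  apply: getPex; have [x Axz] := minty hA gamma0 z.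
  exists x, x => //; exists (gamma *: (gamma^-1 *: (z - x))).
    by eexists; first exact: Axz.
  by rewrite scalerA mulfV ?gt_eqF // scale1r addrC subrK.
rewrite /op_inv /= => -[_ -> [_ [u Au <-] zE]].
have -> : z - resolvent gamma A z = gamma *: u.
  by apply/eqP; rewrite subr_eq addrC zE.
by rewrite scalerA mulVf ?gt_eqF // scale1r.
Qed.

Lemma resolvent_eq (A : H -> set H) (gamma : R) z x :
  maximally_monotone dot A -> 0 < gamma ->
  A x (gamma^-1 *: (z - x)) -> resolvent gamma A z = x.
Proof.
move=> hA gamma0 Ax; apply/eqP; rewrite -subr_eq0; apply/eqP/dot_eq0.
have := hA.1 _ _ _ _ (resolvent_mem z hA gamma0) Ax.
rewrite -scalerBr dotZr pmulr_rge0 ?invr_gt0 // opprB [_ + (x - z)]addrC addrA subrK.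
rewrite -[x - _]opprB dotNr oppr_ge0 => h.
by apply/eqP; rewrite eq_le h dot_ge0.
Qed.

(** * Weak limits *)

Implicit Types (F : set_system nat) (xs ys : nat -> H) (l m : H).

(** Along the filter \oo this is convertible to [weakly_cvg]. *)
Definition weak_cvg_along F xs l :=
  forall u : H, dot (xs k) u @[k --> F] --> dot l u.

(** The scalar limits along F define a bounded linear form L; it is represented
    by the minimizer of |p|^2 - 2 L p, as in the proof of the Riesz theorem. *)
Lemma bounded_weak_ultra_cvg F xs (M : R) : UltraFilter F ->
  (forall k, `|xs k| <= M) -> exists l, weak_cvg_along F xs l.
Proof.
move=> FU xM; have M0 : 0 <= M by apply: le_trans (xM 0%N).
have xuM u k : `|dot (xs k) u| <= M * `|u|.
  by apply: le_trans (cauchy_schwarz _ _) _; rewrite ler_wpM2r.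
have /choice[L LP] (u : H) : exists a : R, dot (xs k) u @[k --> F] --> a.
  exact: bounded_ultra_cvg (xuM u).
have Llin a b u v : L (a *: u + b *: v) = a * L u + b * L v.
  apply: (cvg_unique _ (LP (a *: u + b *: v))) => //.
  rewrite /=; under eq_fun do rewrite dotDr !dotZr.
  by apply: cvgD; apply: cvgMl_tmp.
have LZ a u : L (a *: u) = a * L u.
  by have := Llin a 0 u 0; rewrite mul0r scale0r !addr0.
have LM u : L u <= M * `|u|.
  apply: (cvgr_to_le (LP u)); apply: filterE => k.
  by apply: le_trans (xuM u k); exact: ler_norm.
pose K : set (H * R) := [set p | p.2 = - (2 * L p.1)].
have [|t p q _ pE qE|p ->|w wP] := @convex_minimizer K (- M ^+ 2).
- by exists (0, - (2 * L 0)).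
- by rewrite /K /= Llin pE qE; ring.
- by have := LM p.1; have := sqr_ge0 (`|p.1| - M); lra.
exists w => u; rewrite (_ : dot w u = L u) //.
apply/eqP; rewrite -subr_eq0; apply/negPn/negP => c0.
pose s := (`|w| ^+ 2 - M ^+ 2 - 1) / (2 * (dot w u - L u)).
have := wP (s *: u, - (2 * L (s *: u))) erefl.
rewrite /= LZ dotZr.
have : s * (2 * (dot w u - L u)) = `|w| ^+ 2 - M ^+ 2 - 1.
  by rewrite /s mulrVK // unitfE mulf_neq0 // pnatr_eq0.
lra.
Qed.

Lemma weak_cvg_alongD F xs ys l m : Filter F ->
  weak_cvg_along F xs l -> weak_cvg_along F ys m ->
  weak_cvg_along F (fun k => xs k + ys k) (l + m).
Proof.
move=> FF xl ym u; rewrite dotDl; under eq_fun do rewrite dotDl.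
exact: cvgD.
Qed.

Lemma weak_cvg_alongZ F xs l (a : R) : Filter F ->
  weak_cvg_along F xs l -> weak_cvg_along F (fun k => a *: xs k) (a *: l).
Proof.
move=> FF xl u; rewrite dotZl; under eq_fun do rewrite dotZl.
exact: cvgMl_tmp.
Qed.

Lemma weak_cvg_alongB F xs ys l m : Filter F ->
  weak_cvg_along F xs l -> weak_cvg_along F ys m ->
  weak_cvg_along F (fun k => xs k - ys k) (l - m).
Proof.
move=> FF xl ym u; rewrite dotDl dotNl; under eq_fun do rewrite dotDl dotNl.
exact: cvgB.
Qed.

Lemma cvg_weak_along F xs l : Filter F ->
  xs k @[k --> F] --> l -> weak_cvg_along F xs l.
Proof. by move=> FF xl u; apply: cvg_dot => //; exact: cvg_cst. Qed.

Lemma dot_cvg0 F xs ys (M : R) : Filter F -> (forall k, `|xs k| <= M) ->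
  ys k @[k --> F] --> 0 -> dot (xs k) (ys k) @[k --> F] --> (0 : R).
Proof.
move=> FF xM y0; apply: norm_cvg0.
apply: (@squeeze_cvgr _ _ _ _ (fun=> 0) (fun k => M * `|ys k|)).
- apply: filterE => k; rewrite normr_ge0 /=.
  by apply: le_trans (cauchy_schwarz _ _) _; rewrite ler_wpM2r.
- exact: cvg_cst.
- by rewrite -(mulr0 M); apply: cvgMl_tmp; rewrite -(@normr0 _ H); exact: cvg_norm.
Qed.

Lemma weak_strong_dot_cvg F xs ys l m (M : R) : Filter F ->
  (forall k, `|xs k| <= M) ->
  weak_cvg_along F xs l -> ys k @[k --> F] --> m ->
  dot (xs k) (ys k) @[k --> F] --> dot l m.
Proof.
move=> FF xM xl ym; rewrite -[dot l m]addr0.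
under eq_fun => k do rewrite -[ys k](subrKC m) dotDr.
apply: cvgD; first exact: xl.
apply: dot_cvg0 xM _ => //; rewrite -(subrr m).
by apply: cvgB => //; exact: cvg_cst.
Qed.

Lemma weakly_cvg_ultra xs l (M : R) : (forall k, `|xs k| <= M) ->
  (forall F m, UltraFilter F -> \oo `<=` F ->
     weak_cvg_along F xs m -> m = l) ->
  weakly_cvg dot xs l.
Proof.
move=> xM lP u; apply: cvg_ultra => F FU ooF.
have [m xm] := bounded_weak_ultra_cvg FU xM.
by rewrite -(lP F m).
Qed.

(** Opial's lemma: if l and m are weak limits along two ultrafilters and both
    belong to S, then the difference of the squared distances to l and m
    converges along the whole sequence.  Up to a constant it is twice
    <xs k, l - m>, so l and m have the same inner product with l - m. *)
Lemma opial xs (S : set H) (M : R) : (forall k, `|xs k| <= M) ->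
  (forall s, S s -> exists a : R, dot (xs k - s) (xs k - s) @[k --> \oo] --> a) ->
  (forall F m, UltraFilter F -> \oo `<=` F -> weak_cvg_along F xs m -> S m) ->
  exists l, S l /\ weakly_cvg dot xs l.
Proof.
move=> xM xS clS.
have [F [FU ooF]] := ultraFilterLemma (F := \oo : set_system nat) _.
have [l xl] := bounded_weak_ultra_cvg FU xM.
have Sl := clS F l FU ooF xl.
exists l; split => //; apply: weakly_cvg_ultra xM _ => G m GU ooG xm.
have Sm := clS G m GU ooG xm.
have [a xa] := xS l Sl; have [b xb] := xS m Sm.
pose c := (b - a + dot l l - dot m m) / 2.
have xc : dot (xs k) (l - m) @[k --> \oo] --> c.
  have E k : dot (xs k) (l - m) =
     (dot (xs k - m) (xs k - m) - dot (xs k - l) (xs k - l) + dot l l - dot m m) / 2.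
    by rewrite !dotE (dotC l) (dotC m); field.
  under eq_fun do rewrite E.
  apply: cvgMr_tmp; apply: cvgB; last exact: cvg_cst.
  by apply: cvgD; [exact: cvgB | exact: cvg_cst].
have lc : dot l (l - m) = c.
  by apply: (cvg_unique _ (xl (l - m))) => // P /xc; exact: ooF.
have mc : dot m (l - m) = c.
  by apply: (cvg_unique _ (xm (l - m))) => // P /xc; exact: ooG.
apply/eqP; rewrite eq_sym -subr_eq0; apply/eqP/dot_eq0.
by rewrite [in LHS]dotDl dotNl lc mc subrr.
Qed.

Lemma cvg_sqr_dist (F : set_system nat) (xs : nat -> H) l : Filter F ->
  dot (xs k - l) (xs k - l) @[k --> F] --> (0 : R) -> xs k @[k --> F] --> l.
Proof.
move=> FF xl; apply/cvgrPdist_lt => e e0; near=> k.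
rewrite distrC -(@ltr_pXn2r _ 2) ?nnegrE ?(ltW e0) // sqrnormE.
rewrite -[ltLHS]ger0_norm ?dot_ge0 //; near: k.
by apply: (cvgr0_norm_lt _ xl); rewrite exprn_gt0.
Unshelve. all: by end_near. Qed.

(** * The three-operator residual *)

Section ThreeOperatorSplitting.
Variables (A B : H -> set H) (C : H -> H) (beta gamma epsb : R).
Hypotheses (hA : maximally_monotone dot A) (hB : maximally_monotone dot B).
Hypothesis hC : cocoercive dot beta C.
Hypotheses (epsb0 : 0 < epsb) (epsb2 : epsb < 2).
Hypotheses (gamma0 : 0 < gamma) (gammalt : gamma < 2 * beta * epsb).
Local Notation JA := (resolvent gamma A).
Local Notation JB := (resolvent gamma B).
Local Notation T := (three_operator gamma A B C).

(** Since x_B is J_{gamma B} z, [stepA z], [subgradA z] and [subgradB z] are x_A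
    and the elements of A x_A and B x_B selected by the two resolvents; they
    satisfy subgradA z + subgradB z + C x_B = (x_B - x_A) / gamma. *)
Definition stepA z := JA (2 *: JB z - z - gamma *: C (JB z)).
Definition residual z := JB z - stepA z.
Definition subgradB z := gamma^-1 *: (z - JB z).
Definition subgradA z := gamma^-1 *: residual z - subgradB z - C (JB z).

Lemma stepAE z : stepA z = JB z - residual z.
Proof. by rewrite /residual opprB addrC subrK. Qed.

Lemma three_operatorE z : T z = z - residual z.
Proof. by rewrite /three_operator /residual opprB addrA addrAC. Qed.

Lemma fixed_residual z : T z = z <-> residual z = 0.
Proof.
rewrite three_operatorE; split=> [/eqP|->]; last by rewrite subr0.
by rewrite -subr_eq0 addrAC subrr add0r oppr_eq0 => /eqP.
Qed.

Lemma subgradB_mem z : B (JB z) (subgradB z).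
Proof. exact: resolvent_mem. Qed.

Lemma subgradA_mem z : A (stepA z) (subgradA z).
Proof.
rewrite (_ : subgradA z = gamma^-1 *:
  (2 *: JB z - z - gamma *: C (JB z) - stepA z)); first exact: resolvent_mem.
apply: dot_ext => u; rewrite /subgradA /residual /subgradB !dotE.
by field; rewrite gt_eqF.
Qed.

Lemma fixed_zero z : T z = z -> zer (op_add (op_add A B) (op_of_fun C)) (JB z).
Proof.
move=> /fixed_residual ez; rewrite /zer /op_add /op_of_fun /=.
have xA : stepA z = JB z by apply/esym/eqP; rewrite -subr_eq0; apply/eqP.
exists (subgradA z + subgradB z).
  exists (subgradA z); first by rewrite -xA; exact: subgradA_mem.
  by exists (subgradB z); first exact: subgradB_mem.
exists (C (JB z)) => //.
by apply: dot_ext => u; rewrite /subgradA ez !dotE; ring.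
Qed.

Lemma zero_fixed x : zer (op_add (op_add A B) (op_of_fun C)) x ->
  exists z, T z = z.
Proof.
move=> [_ [u Axu [v Bxv <-]] [_ -> uvC]]; exists (x + gamma *: v).
have xB : JB (x + gamma *: v) = x.
  apply: resolvent_eq => //; rewrite addrAC subrr add0r scalerA mulVf ?gt_eqF //.
  by rewrite scale1r.
apply/fixed_residual; rewrite /residual /stepA xB.
apply/eqP; rewrite subr_eq0 eq_sym; apply/eqP.
apply: resolvent_eq => //; rewrite (_ : gamma^-1 *: _ = u) //.
apply: dot_ext => w; have := congr1 (dot^~ w) uvC; rewrite /= !dotE => uvw.
rewrite (_ : dot u w = - dot v w - dot (C x) w); last by lra.
by field; rewrite gt_eqF.
Qed.

Lemma subgradB_monotone z w :
  0 <= dot (JB z - JB w) (subgradB z - subgradB w).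
Proof. by apply: hB.1; exact: subgradB_mem. Qed.

Lemma subgradA_monotone z w :
  0 <= dot (stepA z - stepA w) (subgradA z - subgradA w).
Proof. by apply: hA.1; exact: subgradA_mem. Qed.

(** Expanding the two monotonicity products, gamma (subgradB z) being z - x_B and
    similarly for A, everything except |r z - r w|^2 and the product with C
    cancels. *)
Lemma residual_identity z w :
  dot (z - w) (residual z - residual w) =
  dot (residual z - residual w) (residual z - residual w) +
  gamma * (dot (stepA z - stepA w) (C (JB z) - C (JB w)) +
           dot (JB z - JB w) (subgradB z - subgradB w) +
           dot (stepA z - stepA w) (subgradA z - subgradA w)).
Proof.
pose dz := z - w; pose dB := JB z - JB w; pose dA := stepA z - stepA w.
pose dC := C (JB z) - C (JB w).
have -> : residual z - residual w = dB - dA.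
  by apply: dot_ext => u; rewrite /residual /dB /dA !dotE; ring.
have -> : subgradB z - subgradB w = gamma^-1 *: (dz - dB).
  by apply: dot_ext => u; rewrite /subgradB /dz /dB !dotE; ring.
have -> : subgradA z - subgradA w = gamma^-1 *: (dB - dA) - gamma^-1 *: (dz - dB) - dC.
  apply: dot_ext => u.
  by rewrite /subgradA /subgradB /residual /dz /dB /dA /dC !dotE; ring.
rewrite -/dz -/dB -/dA -/dC; move: dz dB dA dC => dz dB dA dC.
by rewrite !dotE (dotC dz dB) (dotC dz dA) (dotC dA dB); field; rewrite gt_eqF.
Qed.

(** In [residual_identity], replacing x_A by x_B in the product with C makes
    cocoercivity apply, at the cost of gamma <r z - r w, C x_B(z) - C x_B(w)>,
    which Young's inequality with weight epsb absorbs.  The strict inequality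
    gamma < 2 beta epsb leaves a positive multiple of |C x_B(z) - C x_B(w)|^2. *)
Lemma residual_cocoercive : exists2 c : R, 0 < c & forall z w,
  (2 - epsb) * dot (residual z - residual w) (residual z - residual w) +
  c * dot (C (JB z) - C (JB w)) (C (JB z) - C (JB w)) +
  2 * gamma * (dot (JB z - JB w) (subgradB z - subgradB w) +
               dot (stepA z - stepA w) (subgradA z - subgradA w))
  <= 2 * dot (z - w) (residual z - residual w).
Proof.
exists (2 * gamma * beta - gamma ^+ 2 / epsb).
  have : 0 < gamma * (2 * beta * epsb - gamma) by rewrite mulr_gt0 ?subr_gt0.
  by rewrite subr_gt0 ltr_pdivrMr //; lra.
move=> z w; rewrite residual_identity.
have := hC (JB z) (JB w); rewrite sqrnormE.
set dC := C _ - C _; set e := residual z - residual w.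
have -> : stepA z - stepA w = (JB z - JB w) - e.
  by rewrite /e /residual; apply: dot_ext => u; rewrite !dotE; ring.
clearbody e dC; rewrite (dotDl _ (- e) dC) dotNl => coco.
have young : 0 <= epsb ^+ 2 * dot e e - 2 * epsb * gamma * dot e dC +
    gamma ^+ 2 * dot dC dC.
  have := dot_ge0 (epsb *: e - gamma *: dC); rewrite !dotE (dotC dC e).
  by rewrite !expr2; lra.
have : 2 * gamma * dot e dC <= epsb * dot e e + gamma ^+ 2 / epsb * dot dC dC.
  rewrite -(@ler_pM2l _ epsb) // mulrDr [epsb * (_ / _ * _)]mulrA.
  by rewrite [epsb * (_ / _)]mulrC divfK ?gt_eqF //; lra.
have : 0 <= gamma * (dot (JB z - JB w) dC - beta * dot dC dC).
  by rewrite mulr_ge0 ?subr_ge0 // ltW.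
lra.
Qed.

Lemma resolventB_nonexpansive z w : `|JB z - JB w| <= `|z - w|.
Proof.
have := subgradB_monotone z w.
rewrite (_ : subgradB z - subgradB w =
  gamma^-1 *: ((z - w) - (JB z - JB w))); last first.
  by apply: dot_ext => u; rewrite /subgradB !dotE; ring.
rewrite dotZr pmulr_rge0 ?invr_gt0 // [dot _ _]dotDr dotNr subr_ge0 -sqrnormE.
move=> /le_trans /(_ (ler_norm _)) /le_trans /(_ (cauchy_schwarz _ _)).
have [->|dB0] := eqVneq `|JB z - JB w| 0; first by rewrite normr_ge0.
by rewrite expr2 ler_pM2l // lt_def dB0 normr_ge0.
Qed.

Lemma resolventB_bounded w (ys : nat -> H) (M : R) : (forall k, `|ys k| <= M) ->
  forall k, `|JB (ys k)| <= M + `|w| + `|JB w|.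
Proof.
move=> ysM k; rewrite -[JB (ys k)](subrK (JB w)).
apply: le_trans (ler_normD _ _) _; rewrite lerD2r.
apply: le_trans (resolventB_nonexpansive _ _) _.
by apply: le_trans (ler_normB _ _) _; rewrite lerD2r.
Qed.

(** By [residual_cocoercive] at ys k and l: the right-hand side
    2 <ys k - l, r (ys k) - r l> tends to 0, because ys k - l tends weakly to 0
    and r (ys k) strongly, while the left-hand side bounds |r l|^2 in the
    limit. *)
Lemma residual_demiclosed (F : set_system nat) (ys : nat -> H) (l : H) (M : R) :
  ProperFilter F -> (forall k, `|ys k| <= M) -> weak_cvg_along F ys l ->
  residual (ys k) @[k --> F] --> 0 -> residual l = 0.
Proof.
move=> FF ysM ysl ys0.
have ylM k : `|ys k - l| <= M + `|l|.
  by apply: le_trans (ler_normB _ _) _; rewrite lerD2r.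
have [c c0 key] := residual_cocoercive.
apply: dot_eq0; apply/eqP; rewrite eq_le dot_ge0 andbT.
have lim : dot (ys k - l) (residual (ys k) - residual l) @[k --> F] --> (0 : R).
  under eq_fun do rewrite dotDr dotNr.
  rewrite -(subrr 0); apply: cvgB; first exact: dot_cvg0 ylM ys0.
  under eq_fun do rewrite dotDl dotNl.
  by rewrite -(subrr (dot l (residual l))); apply: cvgB => //; exact: cvg_cst.
have lim' : dot (residual (ys k) - residual l) (residual (ys k) - residual l)
    @[k --> F] --> dot (residual l) (residual l).
  have -> : dot (residual l) (residual l) = dot (0 - residual l) (0 - residual l).
    by rewrite sub0r dotNl dotNr opprK.
  by apply: cvg_dot; apply: cvgB => //; exact: cvg_cst.
rewrite -(@pmulr_rle0 _ (2 - epsb)) ?subr_gt0 // -(mulr0 2).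
apply: (ler_cvg_to (cvgMl_tmp (a := 2 - epsb) lim') (cvgMl_tmp (a := 2) lim)).
apply: filterE => k /=; apply: le_trans (key (ys k) l).
have := mulr_ge0 (ltW c0) (dot_ge0 (C (JB (ys k)) - C (JB l))).
have := mulr_ge0 (ltW gamma0) (subgradB_monotone (ys k) l).
have := mulr_ge0 (ltW gamma0) (subgradA_monotone (ys k) l).
lra.
Qed.

(** All terms on the left of [residual_cocoercive] are nonnegative, so each is
    squeezed to 0 when its right-hand side vanishes. *)
Lemma residual_vanish (F : set_system nat) (ys : nat -> H) (w : H) (M : R) :
  ProperFilter F -> (forall k, `|ys k| <= M) ->
  residual (ys k) @[k --> F] --> 0 -> residual w = 0 ->
  [/\ C (JB (ys k)) @[k --> F] --> C (JB w),
     dot (JB (ys k) - JB w) (subgradB (ys k) - subgradB w)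
       @[k --> F] --> (0 : R) &
     dot (stepA (ys k) - stepA w) (subgradA (ys k) - subgradA w)
       @[k --> F] --> (0 : R)].
Proof.
move=> FF ysM ys0 w0.
have ywM k : `|ys k - w| <= M + `|w|.
  by apply: le_trans (ler_normB _ _) _; rewrite lerD2r.
have [c c0 key] := residual_cocoercive.
pose r k := 2 * dot (ys k - w) (residual (ys k)).
have r0 : r k @[k --> F] --> 0.
  by rewrite -(mulr0 2); apply: cvgMl_tmp; exact: dot_cvg0 ywM ys0.
have squeeze (d : R) (f : nat -> R) : 0 < d -> (forall k, 0 <= f k) ->
    (forall k, d * f k <= r k) -> f k @[k --> F] --> 0.
  move=> d0 f0 fr; apply: (@squeeze_cvgr _ _ _ _ (fun=> 0) (fun k => d^-1 * r k)).
  - apply: filterE => k; rewrite f0 /=.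
    by rewrite -(ler_pM2l d0) mulrA mulfV ?gt_eqF // mul1r.
  - exact: cvg_cst.
  - by rewrite -(mulr0 d^-1); exact: cvgMl_tmp.
have e0 k : 0 <= (2 - epsb) *
    dot (residual (ys k) - residual w) (residual (ys k) - residual w).
  by rewrite mulr_ge0 ?dot_ge0 // subr_ge0 ltW.
have C0 k := dot_ge0 (C (JB (ys k)) - C (JB w)).
have B0 k := subgradB_monotone (ys k) w.
have A0 k := subgradA_monotone (ys k) w.
have rE k := key (ys k) w.
have rE' k : 2 * dot (ys k - w) (residual (ys k) - residual w) = r k.
  by rewrite w0 subr0.
split.
- have : dot (C (JB (ys k)) - C (JB w)) (C (JB (ys k)) - C (JB w))
      @[k --> F] --> (0 : R).
    apply: (squeeze c) => // k.
    have := rE k; rewrite rE'; have := e0 k.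
    have := mulr_ge0 (ltW gamma0) (A0 k); have := mulr_ge0 (ltW gamma0) (B0 k).
    lra.
  exact: cvg_sqr_dist.
- apply: (squeeze (2 * gamma)) => // [|k]; first by rewrite mulr_gt0.
  have := rE k; rewrite rE'; have := e0 k.
  have := mulr_ge0 (ltW c0) (C0 k); have := mulr_ge0 (ltW gamma0) (A0 k).
  lra.
- apply: (squeeze (2 * gamma)) => // [|k]; first by rewrite mulr_gt0.
  have := rE k; rewrite rE'; have := e0 k.
  have := mulr_ge0 (ltW c0) (C0 k); have := mulr_ge0 (ltW gamma0) (B0 k).
  lra.
Qed.

(** Since x_B - x_A tends strongly to 0 and subgradA + subgradB tends strongly to
    - C (JB w), the sum of the monotonicity products of A and B against fixed
    graph points passes to the weak limit, although neither product need
    do so separately: writing ub and ua for the weak limits of the subgradients,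
    <xb - b, ub - b'> + <xb - a, ua - a'> >= 0 for all points of the two graphs.
    If (xb, ub) were not in the graph of B, some (b, b') would make the first
    term negative; then (xb, ua) is in the graph of A by maximality, and it
    makes the second term zero, a contradiction. *)
Lemma resolventB_weak_cluster (F : set_system nat) (ys : nat -> H) (w xb : H) (M : R) :
  ProperFilter F -> (forall k, `|ys k| <= M) ->
  residual (ys k) @[k --> F] --> 0 -> residual w = 0 ->
  weak_cvg_along F ys w -> weak_cvg_along F (fun k => JB (ys k)) xb ->
  JB w = xb.
Proof.
move=> FF ysM ys0 w0 yw yxb.
have JBM := resolventB_bounded w ysM.
pose ub := gamma^-1 *: (w - xb); pose ua := - ub - C (JB w).
have uBub : weak_cvg_along F (fun k => subgradB (ys k)) ub.
  by apply: weak_cvg_alongZ; apply: weak_cvg_alongB.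
have uBM k : `|subgradB (ys k)| <= gamma^-1 * (M + (M + `|w| + `|JB w|)).
  rewrite normrZ gtr0_norm ?invr_gt0 // ler_pM2l ?invr_gt0 //.
  by apply: le_trans (ler_normB _ _) _; exact: lerD.
have [CC _ _] := residual_vanish FF ysM ys0 w0.
pose s k := gamma^-1 *: residual (ys k) - C (JB (ys k)).
have sC : s k @[k --> F] --> - C (JB w).
  rewrite -[- _]sub0r -(scaler0 _ gamma^-1); apply: cvgB => //.
  exact: cvgZl_tmp.
have sum_ge0 (a a' b b' : H) : A a a' -> B b b' ->
    0 <= dot (xb - b) (ub - b') + dot (xb - a) (ua - a').
  move=> Aa Bb; pose e k := residual (ys k).
  pose t k := dot (JB (ys k)) (s k - a' - b') +
    dot (subgradB (ys k)) (e k + a - b) - dot (e k + a) (s k - a') + dot b b'.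
  (* t k is the sum of the two products, rearranged so that every inner product
     pairs a weakly convergent factor with a strongly convergent one. *)
  have t0 k : 0 <= t k.
    have := addr_ge0 (hB.1 _ _ _ _ (subgradB_mem (ys k)) Bb)
                     (hA.1 _ _ _ _ (subgradA_mem (ys k)) Aa).
    have -> : stepA (ys k) = JB (ys k) - e k by rewrite /e /residual opprB addrC subrK.
    have -> : subgradA (ys k) = s k - subgradB (ys k).
      by rewrite /s /subgradA addrAC.
    rewrite /t; move: (JB (ys k)) (subgradB (ys k)) (e k) (s k) => x u e' s'.
    rewrite !dotE (dotC x u) (dotC b u) (dotC a u) (dotC e' u); lra.
  have -> : dot (xb - b) (ub - b') + dot (xb - a) (ua - a') =
     dot xb (- C (JB w) - a' - b') + dot ub (0 + a - b) -
       dot (0 + a) (- C (JB w) - a') + dot b b'.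
    rewrite /ua; move: (ub) => v.
    by rewrite !dotE (dotC xb v) (dotC b v) (dotC a v); lra.
  suff tlim : t k @[k --> F] --> dot xb (- C (JB w) - a' - b') +
      dot ub (0 + a - b) - dot (0 + a) (- C (JB w) - a') + dot b b'.
    by apply: (cvgr_to_ge tlim); exact: filterE.
  have sab : s k - a' - b' @[k --> F] --> - C (JB w) - a' - b'.
    by apply: cvgB; [apply: cvgB => //|]; exact: cvg_cst.
  have eab : e k + a - b @[k --> F] --> 0 + a - b.
    by apply: cvgB; [apply: cvgD => //|]; exact: cvg_cst.
  apply: cvgD; last exact: cvg_cst.
  apply: cvgB.
    apply: cvgD; first exact: weak_strong_dot_cvg JBM yxb sab.
    exact: weak_strong_dot_cvg uBM uBub eab.
  by apply: cvg_dot; [apply: cvgD => //|apply: cvgB => //]; exact: cvg_cst.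
apply: resolvent_eq => //; apply: contrapT => nB.
have [b [b' [Bb neg]]] : exists b b', B b b' /\ dot (xb - b) (ub - b') < 0.
  apply: contrapT => nb; apply: nB; apply: maximally_monotone_mem => // b b' Bb.
  by rewrite leNgt; apply/negP => neg; apply: nb; exists b, b'.
have Aua : A xb ua.
  apply: maximally_monotone_mem => // a a' Aa.
  by have := sum_ge0 _ _ _ _ Aa Bb; lra.
have := sum_ge0 _ _ _ _ Aua Bb; rewrite subrr dot0l addr0.
lra.
Qed.

(** * Strong convergence from uniform monotonicity *)

Lemma cvg0_norm_le (F : set_system nat) (xs ys : nat -> H) (c : R) : Filter F ->
  (forall k, `|xs k| <= c * `|ys k|) ->
  ys k @[k --> F] --> 0 -> xs k @[k --> F] --> 0.
Proof.
move=> FF xy y0; apply/norm_cvg0P.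
apply: (@squeeze_cvgr _ _ _ _ (fun=> 0) (fun k => c * `|ys k|)).
- by apply: filterE => k; rewrite normr_ge0 xy.
- exact: cvg_cst.
- by rewrite -(mulr0 c); apply: cvgMl_tmp; apply/norm_cvg0P.
Qed.

(** The modulus is applied on the bounded set made of x and the terms of the
    sequence: a term at distance at least e from x makes the inner product at
    least psi e > 0. *)
Lemma uniformly_monotone_cvg (D : H -> set H) (xs us : nat -> H) (x u : H) (M : R) :
  uniformly_monotone_on_bounded dot D -> (forall k, `|xs k| <= M) ->
  (forall k, D (xs k) (us k)) -> D x u ->
  dot (xs k - x) (us k - u) @[k --> \oo] --> (0 : R) ->
  xs k @[k --> \oo] --> x.
Proof.
move=> unifD xM Dxu Dx lim0; pose S := range xs `|` [set x].
have [||| psi [[psi0 psi_nd psi_eq0] psiD]] := unifD S.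
- by move=> _ [[k _ <-]|->]; [exists (us k) | exists u].
- by exists x; right.
- exists (M + `|x|); split; first exact: num_real.
  move=> N MN _ [[k _ <-]|->] /=; apply: ltW; apply: le_lt_trans MN.
    by rewrite -[leLHS]addr0 lerD.
  by rewrite lerDr (le_trans _ (xM 0%N)).
apply/cvgrPdist_lt => e e0.
have psie0 : (0 < psi e)%E.
  rewrite lt_neqAle psi0 ?(ltW e0) // andbT eq_sym.
  apply/eqP => /(psi_eq0 _ (ltW e0)) e00.
  by rewrite e00 ltxx in e0.
have [r r0 rpsi] : exists2 r : R, 0 < r & (r%:E <= psi e)%E.
  move: psie0; case: (psi e) => [r|_|//]; first by rewrite lte_fin => r0; exists r.
  by exists 1 => //; rewrite leey.
have /cvgrPdist_lt /(_ _ r0) := lim0; apply: filterS => k.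
rewrite sub0r normrN => tr; rewrite distrC ltNge; apply/negP => ek.
have Sk : S (xs k) by left; exists k.
have Sx : S x by right.
have := psiD _ _ _ _ Sk Sx (Dxu k) Dx.
move=> /(le_trans (psi_nd _ _ (ltW e0) ek)) /(le_trans rpsi).
by rewrite lee_fin leNgt (le_lt_trans (ler_norm _) tr).
Qed.

(** * The inertial iteration *)

Section InertialIteration.
Variables (alpha_ lambda_ : nat -> R) (zs ys : nat -> H).
Variables (alpha lambda sigma delta : R).
Hypothesis hy : forall k, ys k.+1 = zs k.+1 + alpha_ k.+1 *: (zs k.+1 - zs k).
Hypothesis hz : forall k, zs k.+1 = ys k - lambda_ k *: residual (ys k).
Hypothesis alpha1 : alpha < 1.
Hypothesis alpha_nd : forall k, alpha_ k.+1 <= alpha_ k.+2.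
Hypothesis alpha_1 : alpha_ 1%N = 0.
Hypothesis alpha_bd : forall k, 0 <= alpha_ k.+1 <= alpha.
Hypotheses (lambda0 : 0 < lambda) (sigma0 : 0 < sigma) (delta0 : 0 < delta).
Let g := alpha * (1 + alpha) + alpha * delta.
Hypothesis lambda_ge : forall k, lambda <= lambda_ k.+1.
Hypothesis lambda_le : forall k,
  (2 - epsb)^-1 * lambda_ k.+1 * (delta * (1 + g + sigma)) <=
  delta - alpha * (g + sigma).

Let alpha0 : 0 <= alpha.
Proof. by case/andP: (alpha_bd 0) => /le_trans; apply. Qed.

Let g0 : 0 <= g.
Proof. by rewrite /g addr_ge0 ?mulr_ge0 ?addr_ge0 // ltW. Qed.

(** The correction l r(y) has squared norm l^2 |r y|^2, and the cross term
    2 l <y - s, r y> is at least (2 - epsb) l |r y|^2; the factor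
    (2 - epsb) / l - 1 collects both. *)
Lemma relaxed_step (y s : H) (l : R) : 0 < l -> residual s = 0 ->
  dot (y - l *: residual y - s) (y - l *: residual y - s) <=
  dot (y - s) (y - s) - (((2 - epsb)^-1 * l)^-1 - 1) *
     dot (l *: residual y) (l *: residual y).
Proof.
move=> l0 s0; have [c c0 /(_ y s)] := residual_cocoercive.
have := mulr_ge0 (ltW c0) (dot_ge0 (C (JB y) - C (JB s))).
have := mulr_ge0 (ltW gamma0) (subgradB_monotone y s).
have := mulr_ge0 (ltW gamma0) (subgradA_monotone y s).
rewrite s0 subr0; move=> PA PB PC key.
have {PA PB PC key} key : (2 - epsb) * dot (residual y) (residual y) <=
  2 * dot (y - s) (residual y) by lra.
rewrite addrAC; move: (y - s) (residual y) key => v e key.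
rewrite !dotE (dotC e v) invfM invrK.
have -> : ((2 - epsb) * l^-1 - 1) * (l * (l * dot e e)) =
  l * ((2 - epsb) * dot e e) - l * (l * dot e e) by field; rewrite gt_eqF.
have := ler_wpM2l (ltW l0) key; lra.
Qed.

(** The scalar core of the descent, where mu = lambda / (2 - epsb), D0 and D1 are
    the squared norms of two consecutive increments p and n, c is their inner
    product, and D1 - 2 a c + a^2 D0 is the squared norm of n - a p.  The cross
    term is split by Young's inequality with weight q = a + delta mu, for which
    the bound on mu gives (g + sigma) q <= (1 - mu) delta. *)
Lemma inertial_young (a mu D0 D1 c : R) : 0 <= a <= alpha -> 0 < mu ->
  mu * (delta * (1 + g + sigma)) <= delta - alpha * (g + sigma) ->
  0 <= D0 -> 0 <= D1 ->
  (forall q, 0 <= q ^+ 2 * D0 - 2 * q * c + D1) ->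
  a * (1 + a) * D0 - (mu^-1 - 1) * (D1 - 2 * a * c + a ^+ 2 * D0) <=
  g * D0 - (g + sigma) * D1.
Proof.
move=> /andP[a0 aalpha] mu0 mule D00 D10 /(_ (a + delta * mu)).
set q := a + delta * mu.
have q0 : 0 < q by rewrite /q ltr_wpDl // mulr_gt0.
have gs0 : 0 < g + sigma by rewrite ltr_wpDl.
have w1 : (g + sigma) * q <= (1 - mu) * delta.
  by have := ler_wpM2l (ltW gs0) aalpha; rewrite /q; lra.
have w0 : 0 <= 1 - mu.
  by rewrite -(pmulr_lge0 _ delta0); apply: le_trans w1; rewrite mulr_ge0 // ltW.
set E := D1 / q; have DE : D1 = q * E by rewrite /E mulrC divfK // gt_eqF.
have E0 : 0 <= E by rewrite /E divr_ge0 // ltW.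
rewrite {1}DE => yc.
have cE : 2 * c <= E + q * D0.
  by rewrite -(ler_pM2l q0); move: yc; rewrite expr2; lra.
have Nge : mu * (delta * E - a * delta * D0) <= D1 - 2 * a * c + a ^+ 2 * D0.
  by have := ler_wpM2l a0 cE; rewrite DE /q expr2; lra.
have tauN : (1 - mu) * (delta * E - a * delta * D0) <=
    (mu^-1 - 1) * (D1 - 2 * a * c + a ^+ 2 * D0).
  have -> : mu^-1 - 1 = (1 - mu) / mu by field; rewrite gt_eqF.
  by rewrite -[leRHS]mulrA ler_wpM2l // -(ler_pM2l mu0) mulVKf ?gt_eqF.
have := ler_wpM2r E0 w1.
have ga : a * (1 + a) + a * delta * (1 - mu) <= g.
  rewrite /g lerD //; first by rewrite ler_pM ?addr_ge0 // lerD2l.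
  rewrite -mulrA ler_pM ?mulr_ge0 // ?(ltW delta0) //.
  by rewrite ler_piMr ?(ltW delta0) // lerBlDr lerDl ltW.
have := ler_wpM2r D00 ga.
have -> : (g + sigma) * D1 = (g + sigma) * q * E by rewrite DE mulrA.
lra.
Qed.

(** With a = alpha_ k.+1 and p = zs k.+1 - zs k, the extrapolated point satisfies
    |ys k.+1 - s|^2 = (1 + a) |zs k.+1 - s|^2 - a |zs k - s|^2 + a (1 + a) |p|^2;
    [relaxed_step] and [inertial_young] bound the rest. *)
Lemma inertial_descent (s : H) k : residual s = 0 ->
  dot (zs k.+2 - s) (zs k.+2 - s) <=
  dot (zs k.+1 - s) (zs k.+1 - s) +
  alpha_ k.+1 * (dot (zs k.+1 - s) (zs k.+1 - s) - dot (zs k - s) (zs k - s)) -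
  (g + sigma) * dot (zs k.+2 - zs k.+1) (zs k.+2 - zs k.+1) +
  g * dot (zs k.+1 - zs k) (zs k.+1 - zs k).
Proof.
move=> s0.
have l0 : 0 < lambda_ k.+1 by apply: lt_le_trans (lambda_ge k).
have mu0 : 0 < (2 - epsb)^-1 * lambda_ k.+1 by rewrite mulr_gt0 ?invr_gt0 ?subr_gt0.
have := relaxed_step (ys k.+1) l0 s0; rewrite -hz.
have -> : lambda_ k.+1 *: residual (ys k.+1) = ys k.+1 - zs k.+2.
  by rewrite hz opprB addrC subrK.
pose v := zs k.+1 - s; pose p := zs k.+1 - zs k; pose n := zs k.+2 - zs k.+1.
have -> : ys k.+1 - s = v + alpha_ k.+1 *: p by rewrite hy addrAC.
have -> : ys k.+1 - zs k.+2 = alpha_ k.+1 *: p - n.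
  by rewrite hy /n /p; apply: dot_ext => t; rewrite !dotE; ring.
have -> : zs k - s = v - p by rewrite /v /p; apply: dot_ext => t; rewrite !dotE; ring.
rewrite -/v -/p -/n => step.
have young q : 0 <= q ^+ 2 * dot p p - 2 * q * dot n p + dot n n.
  have := dot_ge0 (q *: p - n); clearbody n p.
  by rewrite !dotE (dotC p n) expr2; lra.
have := inertial_young (alpha_bd k) mu0 (lambda_le k) (dot_ge0 p) (dot_ge0 n) young.
move: step; clearbody v p n; move: (dot (zs k.+2 - s) _) => phi2.
set tau := _^-1 - 1.
rewrite !dotE (dotC p v) (dotC p n) !expr2; lra.
Qed.

Lemma inertial_limits (s : H) : residual s = 0 ->
  cvgn (fun k => dot (zs k - s) (zs k - s)) /\
  zs k.+1 - zs k @[k --> \oo] --> 0.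
Proof.
move=> s0; pose d n := dot (zs n - zs n.-1) (zs n - zs n.-1).
have [|||phi_cvg d_cvg] := @inertial_cvg R
    (fun k => dot (zs k - s) (zs k - s)) d alpha_ alpha g sigma _ _ alpha_1
    alpha_nd alpha_bd alpha1 g0 sigma0.
- by move=> n; exact: dot_ge0.
- by move=> n; exact: dot_ge0.
- by move=> n; exact: inertial_descent.
split=> //; apply: cvg_sqr_dist.
under eq_fun do rewrite subr0.
by move: d_cvg; rewrite -cvg_shiftS.
Qed.

Lemma iterates_bounded (s : H) : residual s = 0 -> exists M : R,
  (forall k, `|zs k| <= M) /\ (forall k, `|ys k| <= M).
Proof.
move=> s0; have [phi_cvg _] := inertial_limits s0.
have [M0 M00 phiM] := pinfty_ex_gt0 (cvg_seq_bounded phi_cvg).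
pose M := 1 + M0 + `|s|.
have zM k : `|zs k| <= M.
  rewrite -[zs k](subrK s); apply: le_trans (ler_normD _ _) _; rewrite lerD2r.
  have := phiM k I; rewrite /= -sqrnormE ger0_norm ?sqr_ge0 //.
  have := sqr_ge0 (`|zs k - s| - 1); have := normr_ge0 (zs k - s); rewrite !expr2; lra.
have M_ge0 : 0 <= M := le_trans (normr_ge0 _) (zM 0%N).
exists (3 * M + `|ys 0%N|); split=> [k|[|k]].
- by have := zM k; have := normr_ge0 (ys 0%N); lra.
- by rewrite lerDr mulr_ge0.
have /andP[ak0 ak1] := alpha_bd k.
have : `|ys k.+1| <= `|zs k.+1| + alpha_ k.+1 * (`|zs k.+1| + `|zs k|).
  rewrite hy; apply: le_trans (ler_normD _ _) _; rewrite lerD2l normrZ ger0_norm //.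
  by rewrite ler_wpM2l // ler_normB.
have : alpha_ k.+1 * (`|zs k.+1| + `|zs k|) <= 1 * (M + M).
  apply: ler_pM; rewrite ?addr_ge0 //; first exact: le_trans ak1 (ltW alpha1).
  exact: lerD.
by have := zM k.+1; have := normr_ge0 (ys 0%N); lra.
Qed.

Lemma extrapolation_gap (s : H) : residual s = 0 ->
  ys k - zs k @[k --> \oo] --> 0.
Proof.
move=> s0; have [_ dz] := inertial_limits s0.
rewrite -(cvg_shiftS (fun k => ys k - zs k)) /=.
apply: (cvg0_norm_le (c := 1) _ _ dz) => k.
rewrite hy addrAC subrr add0r normrZ; have /andP[ak0 ak1] := alpha_bd k.
by rewrite ger0_norm // ler_wpM2r // (le_trans ak1) // ltW.
Qed.

(** The relaxed step lambda_ k *: residual (ys k) is ys k - zs k.+1, a difference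
    of two vanishing quantities, and lambda_ is bounded below by lambda. *)
Lemma residual_cvg0 (s : H) : residual s = 0 ->
  residual (ys k) @[k --> \oo] --> 0.
Proof.
move=> s0; have [_ dz] := inertial_limits s0.
rewrite -(cvg_shiftS (fun k => residual (ys k))) /=.
have gap : (ys k.+1 - zs k.+1) - (zs k.+2 - zs k.+1) @[k --> \oo] --> 0.
  rewrite -[0](subrr 0); apply: cvgB.
    by rewrite (cvg_shiftS (fun k => ys k - zs k)); exact: extrapolation_gap s0.
  by rewrite (cvg_shiftS (fun k => zs k.+1 - zs k)).
apply: (cvg0_norm_le (c := lambda^-1) _ _ gap) => k.
rewrite opprB addrA subrK hz opprB addrC subrK normrZ.
rewrite -(ler_pM2l lambda0) mulVKf ?gt_eqF // ler_wpM2r //.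
by apply: le_trans (lambda_ge k) (ler_norm _).
Qed.

Lemma weak_extrapolation (s l : H) (F : set_system nat) : ProperFilter F ->
  \oo `<=` F -> residual s = 0 ->
  weak_cvg_along F zs l -> weak_cvg_along F ys l.
Proof.
move=> FF ooF s0 zl; rewrite -[l]addr0.
rewrite (_ : ys = fun k => zs k + (ys k - zs k)); last first.
  by apply/funext => k; rewrite addrC subrK.
apply: weak_cvg_alongD => //; apply: cvg_weak_along => P P0.
by apply: ooF; exact: extrapolation_gap s0 P P0.
Qed.

Lemma iterates_weakly_cvg (s : H) : residual s = 0 ->
  exists l, residual l = 0 /\ weakly_cvg dot zs l.
Proof.
move=> s0; have [M [zM yM]] := iterates_bounded s0.
apply: (opial (S := [set l | residual l = 0]) zM) => [l l0|F m FU ooF zm].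
  by have [/cvg_ex] := inertial_limits l0.
apply: (residual_demiclosed (F := F) _ yM); last first.
  by move=> P P0; apply: ooF; exact: residual_cvg0 s0 P P0.
exact: weak_extrapolation s0 zm.
Qed.

Lemma resolventB_weakly_cvg (s : H) : residual s = 0 ->
  weakly_cvg dot zs s -> weakly_cvg dot (fun k => JB (ys k)) (JB s).
Proof.
move=> s0 zs_s; have [M [_ yM]] := iterates_bounded s0.
have JBM := resolventB_bounded s yM.
apply: (weakly_cvg_ultra JBM) => F m FU ooF Bm; apply/esym.
apply: (resolventB_weak_cluster (F := F) _ yM _ s0 _ Bm).
  by move=> P P0; apply: ooF; exact: residual_cvg0 s0 P P0.
apply: (weak_extrapolation _ ooF s0) => //.
by move=> u P /zs_s; exact: ooF.
Qed.

Lemma stepA_weakly_cvg (s : H) : residual s = 0 ->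
  weakly_cvg dot zs s -> weakly_cvg dot (fun k => stepA (ys k)) (JB s).
Proof.
move=> s0 zs_s; under eq_fun do rewrite stepAE.
rewrite -[JB s]subr0; apply: weak_cvg_alongB; first exact: resolventB_weakly_cvg.
by apply: cvg_weak_along; exact: residual_cvg0 s0.
Qed.

Lemma stepA_cvgE (s l : H) : residual s = 0 ->
  (stepA (ys k) @[k --> \oo] --> l) <-> (JB (ys k) @[k --> \oo] --> l).
Proof.
move=> s0; have r0 := residual_cvg0 s0.
split=> yl; rewrite -[l]addr0.
  under eq_fun => k do rewrite -[JB (ys k)](subrK (residual (ys k))) -stepAE.
  exact: cvgD.
by under eq_fun do rewrite stepAE; rewrite -[0]oppr0; exact: cvgB.
Qed.

Lemma resolvents_cvg (s : H) : residual s = 0 ->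
  [\/ uniformly_monotone_on_bounded dot A,
      uniformly_monotone_on_bounded dot B |
      weakly_cvg dot zs s /\ demiregular_at dot (op_of_fun C) (JB s)] ->
  stepA (ys k) @[k --> \oo] --> JB s /\ JB (ys k) @[k --> \oo] --> JB s.
Proof.
move=> s0 cond; suff : JB (ys k) @[k --> \oo] --> JB s.
  by move=> JBs; split=> //; apply/(stepA_cvgE _ s0).
have [M [_ yM]] := iterates_bounded s0.
have r0 := residual_cvg0 s0.
have [CC BB AA] := residual_vanish _ yM r0 s0.
have JBM := resolventB_bounded s yM.
case: cond => [unifA|unifB|[zs_s demi]].
- apply/(stepA_cvgE _ s0).
  have [|Mr Mr0 rM] :=
      pinfty_ex_gt0 (cvg_seq_bounded (a := fun k => residual (ys k)) _).
    by apply/cvg_ex; exists 0.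
  rewrite (_ : JB s = stepA s); last by rewrite stepAE s0 subr0.
  apply: (uniformly_monotone_cvg unifA (M := M + `|s| + `|JB s| + Mr) _
     (fun k => subgradA_mem (ys k)) (subgradA_mem s) AA) => k.
  rewrite stepAE; apply: le_trans (ler_normB _ _) _; apply: lerD => //.
  exact: (rM k I).
- exact: (uniformly_monotone_cvg unifB JBM
     (fun k => subgradB_mem (ys k)) (subgradB_mem s) BB).
- apply: (demi (C (JB s)) _ (fun k => JB (ys k)) (fun k => C (JB (ys k)))) => //.
  exact: resolventB_weakly_cvg.
Qed.

End InertialIteration.
End ThreeOperatorSplitting.
End Hilbert.

(** * The convergence theorem *)

Theorem theorem3p1 (R : realType) (H : completeNormedModType R)
  (dot : {dot H for (@idfun R)}) (hdot : induces_norm dot)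
  (A B : H -> set H)
  (hA : maximally_monotone dot A) (hB : maximally_monotone dot B)
  (beta : R) (hbeta : 0 < beta)
  (C : H -> H) (hC : cocoercive dot beta C)
  (hzer : zer (op_add (op_add A B) (op_of_fun C)) !=set0)
  (gamma : R) (alpha_ lambda_ : nat -> R)
  (zm1 : H) (z y xA xB : nat -> H)
  (hy0 : y 0%N = z 0%N + alpha_ 0%N *: (z 0%N - zm1))
  (hy : forall k : nat, y k.+1 = z k.+1 + alpha_ k.+1 *: (z k.+1 - z k))
  (hxB : forall k : nat, xB k = resolvent gamma B (y k))
  (hxA : forall k : nat,
     xA k = resolvent gamma A (2 *: xB k - y k - gamma *: C (xB k)))
  (hz : forall k : nat, z k.+1 = y k + lambda_ k *: (xA k - xB k))
  (* (i1) *)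
  (epsb : R) (hepsb : 0 < epsb < 1) (hgamma : 0 < gamma < 2 * beta * epsb)
  (* (i2) *)
  (alpha : R) (halpha : alpha < 1)
  (halpha_nd : forall k : nat, (1 <= k)%N -> alpha_ k <= alpha_ k.+1)
  (halpha1 : alpha_ 1%N = 0)
  (halpha_ : forall k : nat, (1 <= k)%N -> 0 <= alpha_ k <= alpha)
  (* (i3) *)
  (alphab : R) (halphab : alphab = 1 / (2 - epsb))
  (lambda sigma delta : R)
  (hlambda : 0 < lambda) (hsigma : 0 < sigma) (hdelta : 0 < delta)
  (hdelta_gt :
     delta > (alpha ^+ 2 * (1 + alpha) + alpha * sigma) / (1 - alpha ^+ 2))
  (hlambda_ : forall k : nat, (1 <= k)%N ->
     lambda <= lambda_ k <=
     (delta - alpha * (alpha * (1 + alpha) + alpha * delta + sigma)) /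
     (alphab * delta *
        (1 + alpha * (1 + alpha) + alpha * delta + sigma))) :
  let T := three_operator gamma A B C in
  let JB := resolvent gamma B in
  let ABC := op_add (op_add A B) (op_of_fun C) in
  [/\ (* (i) *)
      exists zs : H, T zs = zs /\ weakly_cvg dot z zs,
      (* (ii) *)
      forall lambda_low : R, 0 < lambda_low ->
      (forall k : nat, (1 <= k)%N -> lambda_low <= lambda_ k) ->
      forall zs : H, T zs = zs ->
        zer ABC (JB zs) /\
        (weakly_cvg dot z zs -> weakly_cvg dot xB (JB zs)),
      (* (iii) *)
      forall lambda_low : R, 0 < lambda_low ->
      (forall k : nat, (1 <= k)%N -> lambda_low <= lambda_ k) ->
      forall zs : H, T zs = zs ->
        zer ABC (JB zs) /\
        (weakly_cvg dot z zs -> weakly_cvg dot xA (JB zs)) &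
      (* (iv) *)
      forall lambda_low : R, 0 < lambda_low ->
      (forall k : nat, (1 <= k)%N -> lambda_low <= lambda_ k) ->
      forall zs : H, T zs = zs ->
        [\/ uniformly_monotone_on_bounded dot A,
            uniformly_monotone_on_bounded dot B |
            weakly_cvg dot z zs /\
            forall x, zer ABC x -> demiregular_at dot (op_of_fun C) x] ->
        [/\ zer ABC (JB zs), xA @ \oo --> JB zs & xB @ \oo --> JB zs]].
Proof.
move=> T JB ABC.
have [epsb0 epsb1] := andP hepsb; have [gamma0 gammalt] := andP hgamma.
have epsb2 : epsb < 2 by lra.
pose r := residual A B C gamma.
have rE z' : T z' = z' <-> r z' = 0 by exact: fixed_residual.
have hz' k : z k.+1 = y k - lambda_ k *: r (y k).
  by rewrite hz hxA hxB /r /residual /stepA -[in RHS]scalerN opprB.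
have xAE : xA = fun k => stepA A B C gamma (y k).
  by apply/funext => k; rewrite hxA hxB.
have xBE : xB = fun k => JB (y k) by apply/funext => k; rewrite hxB.
have [x /(zero_fixed hdot hA hB gamma0)[s0 /rE s00]] := hzer.
have nd k := halpha_nd k.+1 isT.
have bd k := halpha_ k.+1 isT.
have lge k : lambda <= lambda_ k.+1 by case/andP: (hlambda_ k.+1 isT).
have lle k : (2 - epsb)^-1 * lambda_ k.+1 * (delta * (1 +
    (alpha * (1 + alpha) + alpha * delta) + sigma)) <=
    delta - alpha * (alpha * (1 + alpha) + alpha * delta + sigma).
  have /andP[_] := hlambda_ k.+1 isT; rewrite halphab div1r !addrA.
  have alpha0 : 0 <= alpha by case/andP: (bd 0%N) => /le_trans; apply.
  have i0 : 0 < (2 - epsb)^-1 by rewrite invr_gt0 subr_gt0.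
  rewrite ler_pdivlMr; last first.
    by rewrite !mulr_gt0 // ltr_wpDl // !addr_ge0 // mulr_ge0 ?addr_ge0 // ltW.
  by rewrite [lambda_ _ * _]mulrC -!mulrA [lambda_ _ * _]mulrC -!mulrA.
have zsol s : T s = s -> zer ABC (JB s) by exact: fixed_zero.
have weakB s : r s = 0 -> weakly_cvg dot z s -> weakly_cvg dot xB (JB s).
  rewrite xBE; exact: (resolventB_weakly_cvg hdot hA hB hC epsb0 epsb2 gamma0
    gammalt hy hz' halpha nd halpha1 bd hlambda hsigma hdelta lge lle).
have weakA s : r s = 0 -> weakly_cvg dot z s -> weakly_cvg dot xA (JB s).
  rewrite xAE; exact: (stepA_weakly_cvg hdot hA hB hC epsb0 epsb2 gamma0
    gammalt hy hz' halpha nd halpha1 bd hlambda hsigma hdelta lge lle).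
split.
- have [l [/rE Tl zl]] := iterates_weakly_cvg hdot hA hB hC epsb0 epsb2 gamma0
    gammalt hy hz' halpha nd halpha1 bd hlambda hsigma hdelta lge lle s00.
  by exists l.
- by move=> _ _ _ s Ts; split; [exact: zsol | apply: weakB; apply/rE].
- by move=> _ _ _ s Ts; split; [exact: zsol | apply: weakA; apply/rE].
- move=> _ _ _ s Ts cond; have solB := zsol s Ts; have /rE rs := Ts.
  have [] := resolvents_cvg hdot hA hB hC epsb0 epsb2 gamma0
    gammalt hy hz' halpha nd halpha1 bd hlambda hsigma hdelta lge lle rs.
    by case: cond => [?|?|[zs_s demi]];
      [constructor 1 | constructor 2 | constructor 3; split=> //; exact: demi].
  by rewrite xAE xBE; split.
Qed.
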